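(* Let $(N,L)$ be a pair of finite dimensional Lie superalgebras over $\mathbb{F}$ such that $N$ has a complement in $L$ and $\dim N=(m|n)$. Then $$\dim \mathcal{M}(N,L)\leq \frac{1}{2}\big((m+n)^2+(n-m)\big)+\dim N\,\dim(L/N).$$ In particular, if $L$ is abelian then equality holds, and if equality holds then $N\subseteq Z(L)$.
   Context: Let $\mathbb{F}$ be an algebraically closed field of characteristic $\neq 2,3$; all superspaces and superalgebras are over $\mathbb{F}$. A Lie superalgebra is a $\mathbb{Z}_2$-graded vector space $L=L_0\oplus L_1$ with a bilinear bracket such that $[L_a,L_b]\subseteq L_{a+b}$, and for homogeneous $x,y,z$ (with $|x|$ denoting the degree of $x$): $[x,y]=-(-1)^{|x||y|}[y,x]$ and $(-1)^{|x||z|}[x,[y,z]]+(-1)^{|y||x|}[y,[z,x]]+(-1)^{|z||y|}[z,[x,y]]=0$. $L$ is abelian if its bracket is zero, and $Z(L)=\{n\in L\mid [n,x]=0\ \text{for all } x\in L\}$. A graded ideal of $L$ is a $\mathbb{Z}_2$-graded subspace $I$ with $[I,L]\subseteq I$. A pair of Lie superalgebras $(N,L)$ is a Lie superalgebra $L$ together with a graded ideal $N$ of $L$. A complement of $N$ in $L$ is a sub-superalgebra $K$ of $L$ with $L=N\oplus K$ as superspaces. For graded subspaces $A,B$, $[A,B]$ denotes the linear span of all brackets $[a,b]$, $a\in A$, $b\in B$. Schur multiplier: let $0\to R\to F\to L\to 0$ be a free presentation of $L$ (i.e. $F$ is a free Lie superalgebra, and $R$ is the kernel of a surjective homomorphism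 $F\to L$ of Lie superalgebras, homomorphisms being linear maps preserving degree and bracket), and let $S$ be the graded ideal of $F$ with $N\cong S/R$ (the preimage of $N$). Then $\mathcal{M}(N,L)=\dfrac{R\cap[S,F]}{[R,F]}$. This is an abelian Lie superalgebra, independent (up to isomorphism) of the choice of free presentation. Writing $\dim V=(m|n)$ for a superspace $V=V_0\oplus V_1$ means $\dim V_0=m$ and $\dim V_1=n$. In numerical formulas and inequalities, $\dim V$ denotes the total dimension $\dim V_0+\dim V_1$ (so $\dim N$ in the bound is $m+n$). *)

(* Defs.v *)
From HB Require Import structures.
From mathcomp Require Import all_boot all_order all_algebra.
From mathcomp Require Import boolp classical_sets.

Set Implicit Arguments.
Unset Strict Implicit.
Unset Printing Implicit Defensive.

Import GRing.Theory.

Local Open Scope classical_set_scope.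
Local Open Scope ring_scope.

(* Spaces that may be infinite-dimensional (free Lie superalgebras are) are
   lmodTypes, with subspaces given as classical sets. *)
Definition subspace (K : fieldType) (V : lmodType K) (A : set V) : Prop :=
  A 0 /\ forall (a : K) (x y : V), A x -> A y -> A (a *: x + y).

(* The quotient A / B (for subspaces B `<=` A) has finite dimension d:
   the classes of some v_0, ..., v_(d-1) in A form a basis of A / B. *)
Definition has_qdim (K : fieldType) (V : lmodType K) (A B : set V) (d : nat)
    : Prop :=
  exists v : 'I_d -> V,
    [/\ forall i, A (v i),
        forall c : 'I_d -> K, B (\sum_i c i *: v i) -> forall i, c i = 0
      & forall x, A x -> exists c : 'I_d -> K, B (x - \sum_i c i *: v i)].

(* Degrees in Z/2 are booleans (false = 0, true = 1), with addition addb and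
   multiplication andb. *)
HB.mixin Record Lmodule_isLieSuper (K : fieldType) V of GRing.Lmodule K V := {
  lpart : bool -> set V;
  lbr : V -> V -> V;
  lpart_subspace : forall b, subspace (lpart b);
  lpart_sum : forall x, exists x0 x1,
    [/\ lpart false x0, lpart true x1 & x = x0 + x1];
  lpart_direct : forall x, lpart false x -> lpart true x -> x = 0;
  lbr_linearl : forall (a : K) (x y z : V),
    lbr (a *: x + y) z = a *: lbr x z + lbr y z;
  lbr_linearr : forall (a : K) (x y z : V),
    lbr z (a *: x + y) = a *: lbr z x + lbr z y;
  lbr_part : forall a b x y,
    lpart a x -> lpart b y -> lpart (a (+) b) (lbr x y);
  lbr_skew : forall a b x y, lpart a x -> lpart b y ->
    lbr x y = - ((-1) ^+ (a && b) *: lbr y x);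
  lbr_jacobi : forall a b c x y z, lpart a x -> lpart b y -> lpart c z ->
    (-1) ^+ (a && c) *: lbr x (lbr y z) + (-1) ^+ (b && a) *: lbr y (lbr z x)
      + (-1) ^+ (c && b) *: lbr z (lbr x y) = 0
}.

#[short(type="lieSuperType")]
HB.structure Definition LieSuper (K : fieldType) :=
  {V of GRing.Lmodule K V & Lmodule_isLieSuper K V}.

#[short(type="finLieSuperType")]
HB.structure Definition FinLieSuper (K : fieldType) :=
  {V of LieSuper K V & Vector K V}.

Section LieSuperTheory.
Variables (K : fieldType) (L : lieSuperType K).
Implicit Types A B I : set L.

Definition graded_subspace A : Prop :=
  subspace A /\
  forall x, A x -> exists x0 x1,
    [/\ (A `&` lpart false) x0, (A `&` lpart true) x1 & x = x0 + x1].

Definition graded_ideal I : Prop :=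
  graded_subspace I /\ forall x y, I x -> I (lbr x y).

Definition sub_superalgebra A : Prop :=
  graded_subspace A /\ forall x y, A x -> A y -> A (lbr x y).

Definition abelian_lie : Prop := forall x y : L, lbr x y = 0.

Definition lie_center : set L := [set z | forall x, lbr z x = 0].

(* [A, B]: the linear span of the brackets. *)
Definition lbr_span A B : set L :=
  smallest (@subspace K L) [set lbr a b | a in A & b in B].

End LieSuperTheory.

Arguments abelian_lie {K} L.
Arguments lie_center {K} L _.

Definition lie_hom (K : fieldType) (L H : lieSuperType K) (f : L -> H) : Prop :=
  [/\ linear f,
      forall b x, lpart b x -> lpart b (f x)
    & forall x y, f (lbr x y) = lbr (f x) (f y)].

(* F is free on the Z/2-graded set (X, par), embedded by i. *)
Definition free_lie_on (K : fieldType) (F : lieSuperType K)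
    (X : Type) (par : X -> bool) (i : X -> F) : Prop :=
  (forall x, lpart (par x) (i x)) /\
  forall (H : lieSuperType K) (f : X -> H), (forall x, lpart (par x) (f x)) ->
    exists g : F -> H,
      [/\ lie_hom g, forall x, g (i x) = f x
        & forall g' : F -> H, lie_hom g' -> (forall x, g' (i x) = f x) ->
            forall y, g' y = g y].

Definition free_lie (K : fieldType) (F : lieSuperType K) : Prop :=
  exists (X : Type) (par : X -> bool) (i : X -> F), free_lie_on par i.

Definition free_presentation (K : fieldType) (L F : lieSuperType K)
    (p : F -> L) : Prop :=
  [/\ free_lie F, lie_hom p & forall y, exists x, p x = y].

(* dim M(N, L) = d, where M(N, L) = (R :&: [S, F]) / [R, F] is computed from
   the presentation p, with R = ker p and S = p^-1(N). *)
Definition multiplier_dim (K : fieldType) (L F : lieSuperType K) (p : F -> L)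
    (N : set L) (d : nat) : Prop :=
  let R := p @^-1` [set 0] in
  let S := p @^-1` N in
  has_qdim (R `&` lbr_span S [set: F]) (lbr_span R [set: F]) d.

Definition has_complement (K : fieldType) (L : finLieSuperType K)
    (N : {vspace L}) : Prop :=
  exists C : {vspace L},
    [/\ sub_superalgebra [set` C], (N + C)%VS = fullv & (N :&: C)%VS = 0%VS].

(* dim N = (m | n). *)
Definition has_sdim (K : fieldType) (L : finLieSuperType K)
    (N : {vspace L}) (m n : nat) : Prop :=
  exists N0 N1 : {vspace L},
    [/\ [set` N0] = [set` N] `&` lpart false,
        [set` N1] = [set` N] `&` lpart true,
        \dim N0 = m & \dim N1 = n].

(* Main.v *)
Require Import Defs.
From HB Require Import structures.
From mathcomp Require Import all_boot all_order all_algebra.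
From mathcomp Require Import ring lra zify.
From mathcomp Require Import boolp classical_sets.

(** Modulo [R, F] the bracket of two elements of [F] depends only on their images in
[L], since [F / [R, F]] is a central extension of [L]. Choose a homogeneous basis
[e] of [L] whose first [m + n] vectors span [N], and homogeneous lifts [h i] of its
members to [F] ([homogeneous_basis], [homogeneous_lift]). By super-skew-symmetry
[S, F] / [R, F] is spanned by the brackets of [h i] and [h j] with [i < m + n] and
either [i < j], or [i = j] and [e_i] odd ([bracket_spanning]). The number of these
pairs is exactly the bound of the theorem ([card_wedge_pair], [wedge_count_rat]).

The map [p] sends [S, F] / [R, F] onto [N, L], and the multiplier is the kernel of
this map. So its dimension is at most the number of pairs, and equality forces
[N, L] = 0, that is, [N] central ([qdim_ker_of_spanning]).

Conversely, let [L] be abelian. Then [N, L] = 0 and it remains to show that the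
spanning brackets are linearly independent modulo [R, F]. Each super-skew-symmetric
homogeneous bilinear form on [L] defines a central extension of [L] by a line
([central_ext]), and freeness of [F] lifts [p] to it. The central coordinate of the
lift is a linear functional on [F] which vanishes on [R, F] and computes the form
on brackets ([free_superskew_functional]). The forms dual to the pairs separate the
brackets ([wedge_form_basis], [bracket_independent]). *)

Set Implicit Arguments.
Unset Strict Implicit.
Unset Printing Implicit Defensive.

Import Order.TTheory GRing.Theory Num.Theory.

Local Open Scope classical_set_scope.
Local Open Scope ring_scope.

(** * Subspaces *)

Section Subspaces.
Variables (K : fieldType) (V : lmodType K).
Implicit Types A B : set V.

Lemma subspaceD A x y : subspace A -> A x -> A y -> A (x + y).
Proof. by move=> [_ sA] Ax Ay; rewrite -[x]scale1r; apply: sA. Qed.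

Lemma subspaceZ A a x : subspace A -> A x -> A (a *: x).
Proof. by move=> [A0 sA] Ax; rewrite -[_ *: _]addr0; apply: sA. Qed.

Lemma subspaceN A x : subspace A -> A x -> A (- x).
Proof. by move=> sA Ax; rewrite -scaleN1r; apply: subspaceZ. Qed.

Lemma subspaceB A x y : subspace A -> A x -> A y -> A (x - y).
Proof. by move=> sA Ax Ay; apply: subspaceD => //; apply: subspaceN. Qed.

Lemma subspace_sum A (I : finType) (P : pred I) (f : I -> V) :
  subspace A -> (forall i, P i -> A (f i)) -> A (\sum_(i | P i) f i).
Proof.
move=> sA Af; apply: big_ind => //; first by case: sA.
by move=> x y; apply: subspaceD.
Qed.

Lemma subspaceI A B : subspace A -> subspace B -> subspace (A `&` B).
Proof.
move=> [A0 sA] [B0 sB]; split=> [|a x y [Ax Bx] [Ay By]]; first by [].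
by split; [apply: sA|apply: sB].
Qed.

Lemma preimage_subspace (W : lmodType K) (f : {linear W -> V}) A :
  subspace A -> subspace (f @^-1` A).
Proof.
move=> [A0 sA]; split=> [|a x y]; first by rewrite /= linear0.
by rewrite /= linearP; apply: sA.
Qed.

Lemma subspace_set0 : subspace [set (0 : V)].
Proof. by split=> // a x y -> ->; rewrite scaler0 addr0. Qed.

Lemma smallest_subspace (G : set V) : subspace (smallest (@subspace K V) G).
Proof.
split=> [B [[]] //|a x y sx sy B [sB GB]].
by case: (sB) => _; apply; [apply: sx|apply: sy].
Qed.

End Subspaces.

Section SubspacesOfVectType.
Variables (K : fieldType) (V : vectType K).

Lemma vspace_subspace (U : {vspace V}) : subspace [set` U].
Proof. by split=> [|a x y Ux Uy] /=; rewrite ?mem0v // memvD ?memvZ. Qed.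

(** Every subspace of a finite-dimensional space, given as a set, is the carrier of
a [{vspace V}]: any one of maximal dimension inside it. *)
Lemma subspace_vspace (A : set V) :
  subspace A -> exists U : {vspace V}, [set` U] = A.
Proof.
move=> sA; pose P d := `[< exists2 U : {vspace V}, [set` U] `<=` A & \dim U = d >].
have P0 : exists d, P d.
  exists 0%N; apply/asboolP; exists 0%VS; last by rewrite dimv0.
  by move=> x /=; rewrite memv0 => /eqP ->; case: sA.
have leP d : P d -> (d <= \dim {:V})%N.
  by move=> /asboolP[U _ <-]; apply/dimvS/subvf.
case: (ex_maxnP P0 leP) => d /asboolP[U UA dU] maxd.
exists U; apply/seteqP; split=> // x Ax /=.
have sUx : (U <= U + <[x]>)%VS by apply: addvSl.
suff -> : U = (U + <[x]>)%VS by apply: (subvP (addvSr _ _)); apply: memv_line.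
apply/eqP; rewrite eqEdim sUx dU; apply: maxd; apply/asboolP.
exists (U + <[x]>)%VS => // y /= /memv_addP[u Uu [v /vlineP[a ->] ->]].
by apply: subspaceD => //; [apply: UA|apply: subspaceZ].
Qed.

End SubspacesOfVectType.

(** * Dimension of a quotient given by a spanning family *)

Section QuotientDimension.
Variables (K : fieldType) (V W : lmodType K) (q : {linear V -> W}).
Variables (J : finType) (w : J -> V) (A B : set V).

Let coefs := {ffun J -> K^o}.

(** The linear combination of the family [w] with coefficients [c]. *)
Definition lincomb (c : coefs) : V := \sum_j c j *: w j.

Lemma lincomb_is_linear : linear lincomb.
Proof.
move=> a c c'; rewrite /lincomb scaler_sumr -big_split; apply: eq_bigr => j _.
by rewrite !ffunE scalerDl scalerA.
Qed.
HB.instance Definition _ :=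
  GRing.isLinear.Build K coefs V *:%R lincomb lincomb_is_linear.

Lemma dim_coefs : \dim {:coefs} = #|J|.
Proof. by rewrite dimvf /dim /= muln1. Qed.

(** If [A] is spanned modulo [B] by a finite family [w] and the linear map [q] kills
[B], then [(ker q :&: A) / B] has finite dimension at most the size of [w]: it is
a quotient of the space [X] of coefficient vectors whose combination lies in
[ker q], by the space [U] of those whose combination lies in [B]. Its dimension
is the size of [w] only if [X] is everything and [U] is zero. *)
Lemma qdim_ker_of_spanning :
  subspace A -> subspace B -> B `<=` A -> B `<=` q @^-1` [set 0] ->
  (forall j, A (w j)) ->
  (forall x, A x -> exists c : J -> K, B (x - \sum_j c j *: w j)) ->
  exists d, [/\ has_qdim (q @^-1` [set 0] `&` A) B d, (d <= #|J|)%N,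
    (forall j, q (w j) = 0) ->
      (forall c : J -> K, B (\sum_j c j *: w j) -> forall j, c j = 0) ->
      d = #|J|
    & d = #|J| -> forall j, q (w j) = 0].
Proof.
move=> sA sB BA Bq Aw spanA.
have sq : subspace (q @^-1` [set 0]).
  exact: preimage_subspace (subspace_set0 _).
have Acomb c : A (lincomb c).
  by apply: subspace_sum => // j _; apply: subspaceZ.
have [U Udef] := subspace_vspace (preimage_subspace lincomb sB).
have [X Xdef] := subspace_vspace (preimage_subspace lincomb sq).
have UP c : c \in U <-> B (lincomb c).
  by have -> : (c \in U) = ([set` U] c) :> Prop by []; rewrite Udef.
have XP c : c \in X <-> q (lincomb c) = 0.
  by have -> : (c \in X) = ([set` X] c) :> Prop by []; rewrite Xdef.
pose Y := (X :\: U)%VS.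
have YX : (Y <= X)%VS by apply: diffvSl.
have UX : (U <= X)%VS by apply/subvP => c /UP /Bq /XP.
exists (\dim Y); split.
- exists (fun i => lincomb (vbasis Y)`_i).
  have lin c : \sum_(i < \dim Y) c i *: lincomb (vbasis Y)`_i
      = lincomb (\sum_(i < \dim Y) c i *: (vbasis Y)`_i).
    by rewrite linear_sum; apply: eq_bigr => i _; rewrite linearZ.
  have inY c : \sum_(i < \dim Y) c i *: (vbasis Y)`_i \in Y.
    apply: memv_suml => i _; apply/memvZ/vbasis_mem/mem_nth.
    by rewrite size_tuple.
  split=> [i|c|x [qx Ax]].
  + split=> //; apply/XP/(subvP YX)/vbasis_mem/mem_nth.
    by rewrite size_tuple.
  + rewrite lin => /UP Uc.
    have : \sum_(i < \dim Y) c i *: (vbasis Y)`_i \in (Y :&: U)%VS.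
      by rewrite memv_cap inY.
    rewrite capv_diff memv0 => /eqP; apply/freeP.
    exact: basis_free (vbasisP Y).
  + have [c Bc] := spanA x Ax.
    have cE : \sum_j c j *: w j = lincomb (finfun c).
      by apply: eq_bigr => j _; rewrite ffunE.
    rewrite cE in Bc.
    have /XP : q (lincomb (finfun c)) = 0.
      have := Bq _ Bc; rewrite /= linearB qx sub0r => /eqP.
      by rewrite oppr_eq0 => /eqP.
    rewrite -(addv_diff_cap X U) (capv_idPr UX) => /memv_addP[y Yy [u Uu cyu]].
    exists (fun i => coord (vbasis Y) i y); rewrite lin -coord_vbasis //.
    have -> : x - lincomb y = x - lincomb (finfun c) + lincomb u.
      by rewrite cyu linearD opprD addrA subrK.
    by apply: subspaceD => //; apply/UP.
- by rewrite -dim_coefs; apply/dimvS/subvf.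
- move=> qw indep.
  have -> : Y = fullv; last exact: dim_coefs.
  apply/eqP; rewrite eqEsubv subvf; apply/subvP => c _.
  have := addv_diff_cap X U; rewrite (capv_idPr UX).
  have U0 : U = 0%VS.
    apply/eqP; rewrite -subv0; apply/subvP => u /UP Bu.
    by rewrite memv0; apply/eqP/ffunP => j; rewrite ffunE; apply: (indep u).
  rewrite -/Y U0 addv0 => ->; apply/XP; rewrite linear_sum big1 // => j _.
  by rewrite linearZ /= qw scaler0.
- move=> dY j.
  have /eqP <- : lincomb [ffun j' => (j' == j)%:R] == w j.
    rewrite /lincomb (bigD1 j) //= ffunE eqxx scale1r big1 ?addr0 // => i.
    by rewrite ffunE => /negbTE->; rewrite scale0r.
  apply/XP; suff -> : X = fullv by apply: memvf.
  apply/eqP; rewrite eqEdim subvf dim_coefs -dY; exact: dimvS.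
Qed.

End QuotientDimension.

(** * Brackets, homomorphisms and homogeneous lifts *)

Section Brackets.
Variables (K : fieldType) (L : lieSuperType K).
Implicit Types x y z : L.

HB.instance Definition _ x :=
  GRing.isLinear.Build K L L *:%R (lbr x) (fun a u v => lbr_linearr a u v x).

(** The bracket as a function of its left argument. *)
Definition lbr_flip y x : L := lbr x y.

HB.instance Definition _ y :=
  GRing.isLinear.Build K L L *:%R (lbr_flip y) (fun a u v => lbr_linearl a u v y).

Lemma lbrDl x y z : lbr (x + y) z = lbr x z + lbr y z.
Proof. exact: (linearD (lbr_flip z)). Qed.

Lemma lbr_suml (I : finType) (f : I -> L) z :
  lbr (\sum_i f i) z = \sum_i lbr (f i) z.
Proof. exact: (linear_sum (lbr_flip z)). Qed.

Lemma lbrZl a x z : lbr (a *: x) z = a *: lbr x z.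
Proof. exact: (linearZ_LR (lbr_flip z)). Qed.

Lemma lpartN b x : lpart b x -> lpart b (- x).
Proof. exact: subspaceN (lpart_subspace b). Qed.

Lemma lpart_neq b c x : b != c -> lpart b x -> lpart c x -> x = 0.
Proof.
by case: b; case: c => // _ xb xc; apply: lpart_direct.
Qed.

Lemma lbr_span_subspace (A B : set L) : subspace (lbr_span A B).
Proof. exact: smallest_subspace. Qed.

Lemma mem_lbr_span (A B : set L) x y : A x -> B y -> lbr_span A B (lbr x y).
Proof. by move=> Ax By; apply: sub_gen_smallest; exists x => //; exists y. Qed.

(** For graded [A], also [L, A] lies in [A, L]; gradedness matters, since the
skew-symmetry axiom only speaks of homogeneous elements. *)
Lemma mem_lbr_spanr (A : set L) x y :
  graded_subspace A -> A y -> lbr_span A [set: L] (lbr x y).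
Proof.
move=> [_ grA] Ay; have sAL := lbr_span_subspace A [set: L].
have [x0 [x1 [x0P x1P ->]]] := lpart_sum x.
have [y0 [y1 [[Ay0 y0P] [Ay1 y1P] ->]]] := grA y Ay.
have homog b c u v : lpart b u -> lpart c v -> A v ->
    lbr_span A [set: L] (lbr u v).
  move=> ub vc Av; rewrite (lbr_skew _ _ _ _ ub vc).
  apply: (subspaceN sAL); apply: (subspaceZ _ sAL).
  exact: mem_lbr_span.
rewrite lbrDl !linearD; do 2![apply: (subspaceD sAL)];
  by apply: homog; eassumption.
Qed.

End Brackets.

Section Homomorphisms.
Variables (K : fieldType) (L H : lieSuperType K) (f : L -> H).
Hypothesis f_hom : lie_hom f.

Let fl : {linear L -> H} :=
  HB.pack f (GRing.isLinear.Build K L H *:%R f (let: And3 l _ _ := f_hom in l)).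

Lemma ker_graded_subspace : graded_subspace (f @^-1` [set 0]).
Proof.
split; first exact: (preimage_subspace fl (subspace_set0 _)).
move=> x /= fx0; have [x0 [x1 [x0P x1P xE]]] := lpart_sum x.
have [_ fpart _] := f_hom.
have fE : f x0 = - f x1.
  by apply/eqP; rewrite -addr_eq0 -[_ + _](linearD fl) -xE /= fx0.
have f1 : f x1 = 0.
  apply: lpart_direct; last exact: fpart.
  by rewrite -[f x1]opprK -fE; apply/lpartN/fpart.
by exists x0, x1; split=> //; split=> //=; rewrite fE f1 oppr0.
Qed.

Lemma homogeneous_lift b y :
  (forall y, exists x, f x = y) -> lpart b y ->
  exists x, lpart b x /\ f x = y.
Proof.
move=> f_surj yb; have [x fx] := f_surj y.
have [x0 [x1 [x0P x1P xE]]] := lpart_sum x.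
have [_ fpart _] := f_hom.
have yE : y = f x0 + f x1 by rewrite -fx xE; exact: (linearD fl).
case: b yb => yb.
- exists x1; split=> //; suff f0 : f x0 = 0 by rewrite yE f0 add0r.
  apply: lpart_direct; first exact: fpart.
  have -> : f x0 = y - f x1 by rewrite yE addrK.
  by apply: subspaceB => //; [exact: lpart_subspace|exact: fpart].
- exists x0; split=> //; suff f1 : f x1 = 0 by rewrite yE f1 addr0.
  apply: lpart_direct; last exact: fpart.
  have -> : f x1 = y - f x0 by rewrite yE addrC addKr.
  by apply: subspaceB => //; [exact: lpart_subspace|exact: fpart].
Qed.

End Homomorphisms.

(** * Central extensions by super-skew-symmetric forms *)

(** A bilinear form on [L] that is homogeneous of degree [c] and super-skew-symmetric. *)
Record superskew_form (K : fieldType) (L : lieSuperType K) (c : bool)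
    (beta : L -> L -> K) : Prop := SuperskewForm {
  superskew_linearl : forall a x y z,
    beta (a *: x + y) z = a * beta x z + beta y z;
  superskew_linearr : forall a x y z,
    beta z (a *: x + y) = a * beta z x + beta z y;
  superskew_homog : forall a b x y, lpart a x -> lpart b y ->
    a (+) b != c -> beta x y = 0;
  superskew_skew : forall a b x y, lpart a x -> lpart b y ->
    beta x y = - ((-1) ^+ (a && b) * beta y x)
}.

(** The central extension, by a line of degree [c], of the superspace underlying [L]
taken with the zero bracket: the bracket of [(x, s)] and [(y, t)] is
[(0, beta x y)]. The proof that [beta] is a super-skew-symmetric form is a
parameter of the type, so that the Lie superalgebra structure can be inferred. *)
Definition central_ext (K : fieldType) (L : lieSuperType K) (c : bool)
  (beta : L -> L -> K) (_ : superskew_form c beta) : Type := (L * K^o)%type.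

Section CentralExtension.
Variables (K : fieldType) (L : lieSuperType K) (c : bool) (beta : L -> L -> K).
Hypothesis beta_skew : superskew_form c beta.
Notation E := (central_ext beta_skew).

HB.instance Definition _ := GRing.Lmodule.copy E (L * K^o)%type.

(** The central line contributes to the part of degree [c] only. *)
Definition cext_part (b : bool) : set E :=
  [set u | lpart b u.1 /\ (b != c -> u.2 = 0)].

Definition cext_br (u v : E) : E := (0, beta u.1 v.1).

Lemma superskew0 x : beta x 0 = 0.
Proof.
have := superskew_linearr beta_skew 1 0 0 x.
by rewrite scaler0 addr0 mul1r => /eqP; rewrite eq_sym -subr_eq0 addrK => /eqP.
Qed.

(** All double brackets vanish, so the Jacobi identity is trivial. *)
Lemma cext_brr u v w : cext_br u (cext_br v w) = 0.
Proof. by rewrite /cext_br /= superskew0. Qed.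

Lemma cext_part_subspace b : subspace (cext_part b).
Proof.
split=> [|a x y [x1 x2] [y1 y2]].
  by split=> //; case: (@lpart_subspace K L b).
split=> [|bc] /=.
  by apply: subspaceD; [exact: lpart_subspace| |by []];
    apply: subspaceZ => //; exact: lpart_subspace.
by rewrite x2 // y2 // scaler0 addr0.
Qed.

Lemma cext_part_sum u : exists u0 u1,
  [/\ cext_part false u0, cext_part true u1 & u = u0 + u1].
Proof.
case: u => x t; have [x0 [x1 [x0P x1P ->]]] := lpart_sum x.
exists (x0, if c then 0 else t), (x1, if c then t else 0).
split; [by split=> //; case: c|by split=> //; case: c|].
by congr pair; case: c => /=; rewrite ?addr0 ?add0r.
Qed.

Lemma cext_part_direct u : cext_part false u -> cext_part true u -> u = 0.
Proof.
case: u => x t [/= x0 t0] [/= x1 t1].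
rewrite (lpart_direct _ x0 x1); congr pair.
by case: c t0 t1 => t0 t1; [apply: t0|apply: t1].
Qed.

Lemma cext_linearl (a : K) (x y z : E) :
  cext_br (a *: x + y) z = a *: cext_br x z + cext_br y z.
Proof.
congr pair => /=; first by rewrite scaler0 addr0.
exact: superskew_linearl beta_skew _ _ _ _.
Qed.

Lemma cext_linearr (a : K) (x y z : E) :
  cext_br z (a *: x + y) = a *: cext_br z x + cext_br z y.
Proof.
congr pair => /=; first by rewrite scaler0 addr0.
exact: superskew_linearr beta_skew _ _ _ _.
Qed.

Lemma cext_br_part a b x y :
  cext_part a x -> cext_part b y -> cext_part (a (+) b) (cext_br x y).
Proof.
move=> [x1 _] [y1 _]; split=> /=; first by case: (@lpart_subspace K L (a (+) b)).
exact: superskew_homog beta_skew _ _ _ _ x1 y1.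
Qed.

Lemma cext_skew a b x y : cext_part a x -> cext_part b y ->
  cext_br x y = - ((-1) ^+ (a && b) *: cext_br y x).
Proof.
move=> [x1 _] [y1 _]; congr pair => /=; first by rewrite scaler0 oppr0.
exact: superskew_skew beta_skew _ _ _ _ x1 y1.
Qed.

Lemma cext_jacobi a b d x y z : cext_part a x -> cext_part b y ->
  cext_part d z ->
  (-1) ^+ (a && d) *: cext_br x (cext_br y z)
  + (-1) ^+ (b && a) *: cext_br y (cext_br z x)
  + (-1) ^+ (d && b) *: cext_br z (cext_br x y) = 0.
Proof. by move=> *; rewrite !cext_brr !scaler0 !addr0. Qed.

HB.instance Definition _ := Lmodule_isLieSuper.Build K E
  cext_part_subspace cext_part_sum cext_part_direct cext_linearl cext_linearr
  cext_br_part cext_skew cext_jacobi.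

(** When [L] is abelian, every super-skew-symmetric form on [L] is computed by a
linear functional on the free Lie superalgebra presenting [L]. By freeness [p]
lifts to the central extension of [L] by [beta]; the functional is the central
coordinate of the lift. *)
Lemma free_superskew_functional (F : lieSuperType K) (p : F -> L) :
  abelian_lie L -> free_lie F -> lie_hom p ->
  exists f : {linear F -> K^o}, forall x y, f (lbr x y) = beta (p x) (p y).
Proof.
move=> Lab [X [par [i [ipar univ]]]] p_hom.
have [_ p_part p_br] := p_hom.
have [|g [[glin gpart gbr] gi _]] := univ E (fun x => (p (i x), 0)).
  by move=> x; split=> //; apply: p_part.
have [g' [_ _ g'uniq]] := univ L (p \o i) (fun x => p_part _ _ (ipar x)).
have gp : forall x, (g x).1 = p x.
  have g1hom : lie_hom (fst \o g : F -> L).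
    split=> [a x y|b x /gpart[]//|x y /=]; first by rewrite /= glin.
    by rewrite gbr Lab.
  have g1i x : (fst \o g) (i x) = (p \o i) x by rewrite /= gi.
  (* Both [fst \o g] and [p] extend [p \o i], so freeness identifies them. *)
  move=> x; transitivity (g' x); first exact: (g'uniq _ g1hom g1i x).
  by symmetry; apply: (g'uniq p).
have flin : linear (snd \o g : F -> K^o) by move=> a x y; rewrite /= glin.
pose f : {linear F -> K^o} := HB.pack (snd \o g : F -> K^o)
  (GRing.isLinear.Build K F K^o *:%R (snd \o g : F -> K^o) flin).
by exists f => x y; rewrite /= gbr /= !gp.
Qed.

End CentralExtension.

(** * Homogeneous bases and dual forms *)

(** If every vector of a basis lies in one of two subspaces meeting trivially, the
elements of the first have no coordinates on basis vectors of the second. *)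
Lemma coord_disjoint (K : fieldType) (V : vectType K) D (e : D.-tuple V)
    (P : pred 'I_D) (A B : set V) x i :
  basis_of fullv e -> subspace A -> subspace B ->
  (forall y, A y -> B y -> y = 0) ->
  (forall j, P j -> A e`_j) -> (forall j, ~~ P j -> B e`_j) ->
  A x -> ~~ P i -> coord e i x = 0.
Proof.
move=> e_basis sA sB AB0 Ae Be Ax nPi.
pose y := \sum_(j | P j) coord e j x *: e`_j.
pose z := \sum_(j | ~~ P j) coord e j x *: e`_j.
have xE : x = y + z by rewrite {1}(coord_basis e_basis (memvf x)) (bigID P).
have z0 : z = 0.
  apply: AB0.
    have -> : z = x - y by rewrite xE addrC addKr.
    by apply: subspaceB => //; apply: subspace_sum => // j /Ae; apply: subspaceZ.
  by apply: subspace_sum => // j /Be; apply: subspaceZ.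
have zE : z = \sum_j (if ~~ P j then coord e j x else 0) *: e`_j.
  rewrite /z big_mkcond; apply: eq_bigr => j _.
  by case: ifP => _ //; rewrite scale0r.
have := coord_sum_free (fun j => if ~~ P j then coord e j x else 0) i
  (basis_free e_basis).
by rewrite -zE z0 linear0 nPi.
Qed.

Lemma qdim_codim (K : fieldType) (V : vectType K) (U : {vspace V}) k :
  has_qdim [set: V] [set` U] k -> \dim {:V} = (\dim U + k)%N.
Proof.
move=> [v [_ v_free v_span]]; pose t := [tuple v i | i < k].
have tE (c : 'I_k -> K) : \sum_i c i *: t`_i = \sum_i c i *: v i.
  by apply: eq_bigr => i _; rewrite -tnth_nth tnth_mktuple.
have t_free : free t.
  by apply/freeP => c; rewrite tE => c0; apply: v_free; rewrite c0 /= mem0v.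
have -> : fullv = (U + <<t>>)%VS.
  apply/eqP; rewrite eqEsubv subvf andbT; apply/subvP => x _.
  have [c Uc] := v_span x I; rewrite -[x](subrK (\sum_i c i *: v i)).
  apply: memv_add => //; rewrite -tE; apply: memv_suml => i _.
  by apply/memvZ/memv_span/mem_nth; rewrite size_tuple.
rewrite dimv_disjoint_sum; first by rewrite (eqnP t_free) size_tuple.
apply/eqP; rewrite -subv0; apply/subvP => x; rewrite memv_cap => /andP[Ux].
move=> /coord_span xE; rewrite memv0 xE big1 // => i _.
by rewrite (v_free (fun j => coord t j x)) ?scale0r // -tE -xE.
Qed.

Section HomogeneousBases.
Variables (K : fieldType) (L : finLieSuperType K) (D : nat).
Variables (par : 'I_D -> bool) (e : D.-tuple L).
Hypotheses (e_basis : basis_of fullv e) (e_part : forall i, lpart (par i) e`_i).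

Lemma coord_lpart b x i : lpart b x -> par i != b -> coord e i x = 0.
Proof.
move=> xb; apply: (coord_disjoint (P := fun i => par i == b) e_basis
  (lpart_subspace b) (lpart_subspace (~~ b)) _ _ _ xb) => [y yb ynb|j /eqP<- //|j jb].
  by apply: (lpart_neq _ yb ynb); case: (b).
by have -> : ~~ b = par j by case: (b) (par j) jb => [] [].
Qed.

Lemma coord_lpartE b x i : lpart b x ->
  coord e i x = if par i == b then coord e i x else 0.
Proof. by move=> xb; case: ifPn => // /coord_lpart ->. Qed.

(** The super-skew-symmetrization of [(x, y) |-> x_i * y_j], where [x_i] is the
[i]-th coordinate of [x]. It sends [(e_i, e_j)] to [1] if [i != j], and
[(e_i, e_i)] to [2] or [0] as [e_i] is odd or even. *)
Definition wedge_form (i j : 'I_D) (x y : L) : K :=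
  coord e i x * coord e j y
  - (-1) ^+ (par i && par j) * (coord e j x * coord e i y).

Lemma wedge_form_superskew i j :
  superskew_form (par i (+) par j) (wedge_form i j).
Proof.
split=> [a x y z|a x y z|a b x y xa yb|a b x y xa yb]; rewrite /wedge_form.
- by rewrite !linearP /= !mulrDl; ring.
- by rewrite !linearP /= !mulrDr; ring.
- rewrite (coord_lpartE i xa) (coord_lpartE j xa).
  rewrite (coord_lpartE i yb) (coord_lpartE j yb).
  case: (par i) (par j) a b {xa yb} => [] [] [] [] //= _; ring.
- rewrite (coord_lpartE i xa) (coord_lpartE j xa).
  rewrite (coord_lpartE i yb) (coord_lpartE j yb).
  case: (par i) (par j) a b {xa yb} => [] [] [] [] /=; ring.
Qed.

(** Indices of a basis of the image of the tensor product of [N] and [L] in the super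
exterior square of [L], when the first [M] vectors of the basis span [N]: pairs
[i < j] with [i < M], and the squares of odd basis vectors of [N]. *)
Definition wedge_pair (M : nat) (ij : 'I_D * 'I_D) : bool :=
  (ij.1 < M)%N && ((ij.1 < ij.2)%N || (ij.1 == ij.2) && par ij.1).

(** On the chosen pairs the forms and the pairs of basis vectors are dual up to the
factor [2] at squares of odd vectors, whence the hypothesis on the characteristic. *)
Lemma wedge_form_basis M i j a b : 2%N \notin [pchar K] ->
  wedge_pair M (i, j) -> wedge_pair M (a, b) ->
  (wedge_form i j e`_a e`_b != 0) = ((a, b) == (i, j)).
Proof.
move=> char2; rewrite /wedge_pair /= /wedge_form.
rewrite !coord_free ?(basis_free e_basis) //.
move=> /andP[_ ij] /andP[_ ab]; rewrite xpair_eqE.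
have le_ij : (i <= j)%N by case/orP: ij => [/ltnW|/andP[/eqP->]].
have le_ab : (a <= b)%N by case/orP: ab => [/ltnW|/andP[/eqP->]].
have [aj|aj] := eqVneq a j; have [bi|bi] := eqVneq b i;
  rewrite ?mulr0 ?mul0r ?mulr0 ?subr0 -?natrM ?mulnb.
(* Since [a <= b = i <= j = a], all four indices coincide. *)
- have ij_eq : i = j by apply/val_inj/eqP; rewrite eqn_leq le_ij -bi -aj.
  move: ij; rewrite bi aj ij_eq !eqxx ltnn /= => ->; rewrite expr1 mulr1.
  by rewrite opprK -[1 + 1]/(2%:R : K); move: char2; rewrite inE.
all: by case: (_ && _); rewrite ?oner_eq0 ?eqxx.
Qed.

End HomogeneousBases.

(** * Counting the pairs *)

Lemma sum_leq_ord D a : (\sum_(j < D) (a <= j) = D - a)%N.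
Proof. by elim: D => [|D IH]; rewrite ?big_ord0 // big_ord_recr /= IH; lia. Qed.

Lemma card_wedge_pair M k (par : 'I_(M + k) -> bool) :
  (#|{: {ij | wedge_pair par M ij}}| =
    'C(M, 2) + \sum_(i < M + k | i < M) par i + M * k)%N.
Proof.
rewrite card_sig -sum1_card.
rewrite -(pair_big_dep (fun i : 'I_(M + k) => (i < M)%N)
  (fun i j : 'I_(M + k) => (i < j)%N || (i == j) && par i) (fun _ _ => 1%N)) /=.
under eq_bigr => i _.
  rewrite big_mkcond (eq_bigr (fun j : 'I__ => (i < j) + (i == j) * par i)%N).
    rewrite big_split sum_leq_ord -big_distrl (bigD1 i) //= eqxx.
    rewrite big1 ?addn0 ?mul1n; last by move=> j /negbTE; rewrite eq_sym => ->.
    over.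
  move=> j _; have [->|_] := eqVneq i j; first by rewrite ltnn; case: (par j).
  by rewrite orbF; case: ltnP.
rewrite big_split /= addnAC; congr addn.
have := big_ord_widen (M + k) (fun i => M + k - i.+1)%N (leq_addr k M).
move=> <-; elim: M {par} => [|M IH]; first by rewrite big_ord0.
rewrite big_ord_recl /= binS bin1.
rewrite (eq_bigr (fun i : 'I_M => M + k - i.+1)%N);
  last by move=> i _; rewrite /bump; lia.
rewrite IH; lia.
Qed.

(** * A homogeneous basis adapted to the ideal *)

Section GradedVspaces.
Variables (K : fieldType) (L : finLieSuperType K).
Implicit Types U : {vspace L}.

Lemma graded_vspace U : exists U0 U1 : {vspace L},
  [set` U0] = [set` U] `&` lpart false /\ [set` U1] = [set` U] `&` lpart true.
Proof.
have part b := subspace_vspace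
  (subspaceI (vspace_subspace U) (@lpart_subspace K L b)).
by have [U0 ?] := part false; have [U1 ?] := part true; exists U0, U1.
Qed.

Lemma graded_basis U U0 U1 : graded_subspace [set` U] ->
  [set` U0] = [set` U] `&` lpart false ->
  [set` U1] = [set` U] `&` lpart true ->
  basis_of U (vbasis U0 ++ vbasis U1).
Proof.
move=> [_ Ugr] U0E U1E.
have U0P x : x \in U0 <-> x \in U /\ lpart false x.
  by have -> : (x \in U0) = ([set` U0] x) :> Prop by []; rewrite U0E.
have U1P x : x \in U1 <-> x \in U /\ lpart true x.
  by have -> : (x \in U1) = ([set` U1] x) :> Prop by []; rewrite U1E.
have -> : U = (U0 + U1)%VS.
  apply/eqP; rewrite eqEsubv; apply/andP; split.
    apply/subvP => x Ux; have [x0 [x1 [[Ux0 x0P] [Ux1 x1P] ->]]] := Ugr x Ux.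
    by apply: memv_add; [apply/U0P|apply/U1P].
  by rewrite subv_add; apply/andP; split; apply/subvP => x;
    [case/U0P|case/U1P].
apply: cat_basis; rewrite ?vbasisP //; apply/directv_addP/eqP.
rewrite -subv0; apply/subvP => x; rewrite memv_cap => /andP[/U0P[_ x0] /U1P[_ x1]].
by rewrite memv0 (lpart_direct _ x0 x1).
Qed.

(** A basis of [L] made of homogeneous vectors, the first [m + n] of which span [N]
and include exactly [n] odd ones. *)
Lemma homogeneous_basis (N : {vspace L}) m n k :
  graded_subspace [set` N] -> has_complement N -> has_sdim N m n ->
  has_qdim [set: L] [set` N] k ->
  exists (par : 'I_(m + n + k) -> bool) (e : (m + n + k).-tuple L),
    [/\ basis_of fullv e, forall i, lpart (par i) e`_i,
      forall i : 'I_(m + n + k), (i < m + n)%N -> e`_i \in N,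
      forall x (i : 'I_(m + n + k)), x \in N -> (m + n <= i)%N -> coord e i x = 0
    & (\sum_(i < m + n + k | i < m + n) par i = n)%N].
Proof.
move=> Ngr [C [[Cgr _] NC NC0]] [N0 [N1 [N0E N1E dN0 dN1]]] /qdim_codim dimL.
have [C0 [C1 [C0E C1E]]] := graded_vspace C.
have N_basis := graded_basis Ngr N0E N1E.
have C_basis := graded_basis Cgr C0E C1E.
set bN := _ ++ _ in N_basis; set bC := _ ++ _ in C_basis.
have size_bN : size bN = (m + n)%N by rewrite size_cat !size_tuple dN0 dN1.
have dimN : \dim N = (m + n)%N by rewrite (size_basis N_basis) dN0 dN1.
have dimC : \dim C = k.
  by apply/eqP; rewrite -(eqn_add2l (\dim N)) -dimL -NC dimv_disjoint_sum.
have size_bC : size bC = k.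
  by rewrite size_cat !size_tuple -dimC (size_basis C_basis).
have e_size : size (bN ++ bC) == (m + n + k)%N by rewrite size_cat size_bN size_bC.
pose e := Tuple e_size.
have e_basis : basis_of fullv e.
  by rewrite -NC; apply: cat_basis => //; apply/directv_addP.
have partP (U U0 U1 : {vspace L}) d0 d1 i : [set` U0] = [set` U] `&` lpart false ->
    [set` U1] = [set` U] `&` lpart true ->
    \dim U0 = d0 -> \dim U1 = d1 -> (i < d0 + d1)%N ->
    lpart (d0 <= i)%N (vbasis U0 ++ vbasis U1)`_i.
  move=> U0E U1E <- <- iU; rewrite nth_cat size_tuple; case: ltnP => i0.
    have : [set` U0] (vbasis U0)`_i by apply/vbasis_mem/mem_nth; rewrite size_tuple.
    by rewrite U0E => -[].
  have : [set` U1] (vbasis U1)`_(i - \dim U0).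
    by apply/vbasis_mem/mem_nth; rewrite size_tuple; lia.
  by rewrite U1E => -[].
have eN (i : 'I_(m + n + k)) : (i < m + n)%N -> e`_i \in N.
  move=> iN; rewrite nth_cat size_bN iN; apply: (basis_mem N_basis).
  by apply: mem_nth; rewrite size_bN.
exists (fun i : 'I__ => if (i < m + n)%N then (m <= i)%N
                        else (\dim C0 <= i - (m + n))%N), e.
split=> // [i|x i xN iN|].
- rewrite nth_cat size_bN; case: ltnP => iN.
    exact: (partP _ _ _ _ _ _ N0E N1E dN0 dN1 iN).
  apply: (partP C C0 C1 _ (\dim C1)) => //; move: size_bC (ltn_ord i).
  by rewrite size_cat !size_tuple; lia.
- apply: (coord_disjoint (P := fun i : 'I__ => (i < m + n)%N) e_basis
    (vspace_subspace N) (vspace_subspace C)) => // [y Ny Cy|j jN|].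
  + by apply/eqP; rewrite -memv0 -NC0 memv_cap; apply/andP.
  + rewrite /= nth_cat size_bN (negbTE jN); apply: (basis_mem C_basis).
    by apply: mem_nth; rewrite size_bC; move: jN (ltn_ord j); lia.
  + by rewrite -leqNgt.
- rewrite (eq_bigr (fun i : 'I__ => (m <= i)%N : nat)) => [|i ->//].
  rewrite -(big_ord_widen _ (fun i => (m <= i)%N : nat) (leq_addr k (m + n))).
  by rewrite sum_leq_ord addKn.
Qed.

End GradedVspaces.

(** * The space [S, F] / [R, F] *)

Section RelativeBrackets.
Variables (K : fieldType) (L : finLieSuperType K) (F : lieSuperType K).
Variables (p : F -> L) (N : {vspace L}) (D M : nat).
Variables (par : 'I_D -> bool) (e : D.-tuple L) (h : 'I_D -> F).
Hypotheses (char2 : 2%N \notin [pchar K]) (p_hom : lie_hom p).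
Hypotheses (e_basis : basis_of fullv e) (e_part : forall i, lpart (par i) e`_i).
Hypothesis coordN0 : forall x (i : 'I_D), x \in N -> (M <= i)%N -> coord e i x = 0.
Hypothesis h_lift : forall i, lpart (par i) (h i) /\ p (h i) = e`_i.

Notation J := {ij | wedge_pair par M ij}.
Notation R := (p @^-1` [set 0]).
Notation S := (p @^-1` [set` N]).
Notation RF := (lbr_span R [set: F]).

(** The brackets in [F] of the lifts [h i] of the basis vectors [e_i]. *)
Definition wedge_br (ij : J) : F := lbr (h (val ij).1) (h (val ij).2).

Let pl : {linear F -> L} :=
  HB.pack p (GRing.isLinear.Build K F L *:%R p (let: And3 l _ _ := p_hom in l)).

(** Modulo [R, F] the bracket of [s] and [f] only depends on their images in [L], so
it is a combination of brackets [lbr (h i) (h j)] with [i < M]; skew-symmetry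
reduces these to the pairs with [i < j] or with [i = j] odd. *)
Lemma bracket_spanning x : lbr_span S [set: F] x ->
  exists c : J -> K, RF (x - \sum_ij c ij *: wedge_br ij).
Proof.
have sRF : subspace RF := lbr_span_subspace _ _.
pose T : set F := [set x |
    exists c : J -> K, RF (x - \sum_ij c ij *: wedge_br ij)].
have sT : subspace T.
  split=> [|a y z [cy Ty] [cz Tz]].
    exists (fun _ => 0); rewrite big1 => [|ij _]; last by rewrite scale0r.
    by rewrite subr0; case: sRF.
  exists (fun ij => a * cy ij + cz ij).
  under eq_bigr do rewrite scalerDl -scalerA.
  rewrite big_split /= -scaler_sumr opprD addrACA -scalerBr.
  by case: sRF => _; apply.
have RFT : RF `<=` T.
  move=> y Ry; exists (fun _ => 0); rewrite big1 => [|ij _]; last by rewrite scale0r.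
  by rewrite subr0.
have Tbr ij : wedge_pair par M ij -> T (lbr (h ij.1) (h ij.2)).
  move=> ijP; exists (fun ij' => (val ij' == ij)%:R).
  rewrite (bigD1 (exist _ ij ijP : J)) //= eqxx scale1r big1 ?addr0.
    by rewrite subrr; case: sRF.
  by move=> ij' ne;
    rewrite (inj_eq val_inj ij' (exist _ ij ijP : J)) (negbTE ne) scale0r.
have hh (i j : 'I_D) : (i < M)%N -> T (lbr (h i) (h j)).
  move=> iM; have [hi _] := h_lift i; have [hj _] := h_lift j.
  have [ij|ji|/val_inj ij] := ltngtP i j.
  - by apply: (Tbr (i, j)); rewrite /wedge_pair /= iM ij.
  - rewrite (lbr_skew _ _ _ _ hi hj); apply: (subspaceN sT); apply: (subspaceZ _ sT).
    by apply: (Tbr (j, i)); rewrite /wedge_pair /= ji (ltn_trans ji iM).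
  - rewrite -ij; case par_i: (par i).
      by apply: (Tbr (i, i)); rewrite /wedge_pair /= iM eqxx par_i orbT.
    (* The bracket of an even element with itself is its own opposite, hence zero
       in characteristic other than 2. *)
    have := lbr_skew _ _ _ _ hi hi; rewrite par_i expr0 scale1r => /eqP.
    rewrite -addr_eq0 -mulr2n -scaler_nat scaler_eq0 => /orP[|/eqP->].
      by move: char2; rewrite inE /= => /negbTE ->.
    by case: sT.
suff SFT : lbr_span S [set: F] `<=` T by apply: SFT.
apply: (smallest_sub sT) => _ [s /= sN [f _ <-]].
pose lift (y : F) := \sum_i coord e i (p y) *: h i.
have liftP y : R (y - lift y).
  rewrite /= -[p _]/(pl _) linearB linear_sum.
  under eq_bigr do rewrite linearZ_LR /= (h_lift _).2.
  by rewrite -(coord_basis e_basis (memvf (p y))) subrr.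
rewrite -[s](subrK (lift s)) lbrDl.
apply: (subspaceD sT); first exact: RFT (mem_lbr_span (liftP s) I).
rewrite -[f](subrK (lift f)) linearD /=; apply: (subspaceD sT).
  exact: RFT (mem_lbr_spanr _ (ker_graded_subspace p_hom) (liftP f)).
rewrite /lift lbr_suml; apply: subspace_sum => // i _; rewrite lbrZl.
case: (ltnP i M) => iM; last by rewrite coordN0 // scale0r; case: sT.
apply: (subspaceZ _ sT); rewrite linear_sum; apply: subspace_sum => // j _.
by rewrite linearZ_LR; apply: (subspaceZ _ sT); apply: hh.
Qed.

(** For abelian [L] the functional on [F] computing the form dual to a pair [ij]
kills [R, F], and hence isolates the coefficient of [ij]. *)
Lemma bracket_independent (c : J -> K) : abelian_lie L -> free_lie F ->
  RF (\sum_ij c ij *: wedge_br ij) -> forall ij, c ij = 0.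
Proof.
move=> Lab freeF cRF ij.
have [f fE] := free_superskew_functional
  (wedge_form_superskew e_basis e_part (val ij).1 (val ij).2) Lab freeF p_hom.
have f0 : RF `<=` f @^-1` [set 0].
  apply: smallest_sub; first exact: preimage_subspace (subspace_set0 _).
  move=> _ [r /= pr0 [y _ <-]].
  by rewrite /= fE pr0 /wedge_form !linear0 !mul0r mulr0 subrr.
have := f0 _ cRF; rewrite /= linear_sum (bigD1 ij) //= big1 ?addr0 => [|ij' ne].
  rewrite linearZ /= fE !(h_lift _).2 => /eqP; rewrite mulf_eq0 => /orP[/eqP //|].
  by rewrite -[_ == 0]negbK (wedge_form_basis e_basis char2 (M := M))
    -?surjective_pairing ?eqxx ?(valP ij).
rewrite linearZ /= fE !(h_lift _).2; apply/eqP; rewrite mulf_eq0; apply/orP; right.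
by rewrite -[_ == 0]negbK (wedge_form_basis e_basis char2 (M := M))
  -?surjective_pairing ?(valP ij) ?(valP ij').
Qed.

End RelativeBrackets.

Lemma wedge_count_rat m n k :
  ('C(m + n, 2) + n + (m + n) * k)%:R =
    1 / 2 * ((m%:R + n%:R) ^+ 2 + (n%:R - m%:R)) + (m%:R + n%:R) * k%:R :> rat.
Proof.
have bin : ('C(m + n, 2) * 2 + (m + n) = (m + n) * (m + n))%N.
  rewrite (bin_ffact _ 2) ffactnS ffactn1.
  by case: (m + n)%N => // M; lia.
have /(congr1 (fun x => x%:R : rat)) := bin.
rewrite !(natrD, natrM) => binQ; lra.
Qed.

Theorem theorem3p7 (K : closedFieldType)
    (char_neq2 : 2%N \notin [pchar K]) (char_neq3 : 3%N \notin [pchar K])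
    (L : finLieSuperType K) (N : {vspace L}) (m n k : nat)
    (idealN : graded_ideal [set` N])
    (complN : has_complement N)
    (dimN : has_sdim N m n)
    (dimLN : has_qdim [set: L] [set` N] k)
    (F : lieSuperType K) (p : F -> L) (freeF : free_presentation p) :
  let bound : rat :=
    1 / 2 * ((m%:R + n%:R) ^+ 2 + (n%:R - m%:R)) + (m%:R + n%:R) * k%:R in
  exists d : nat,
    [/\ multiplier_dim p [set` N] d,
        d%:R <= bound,
        abelian_lie L -> d%:R = bound
      & d%:R = bound -> [set` N] `<=` lie_center L].
Proof.
move=> bound; have [free_F p_hom p_surj] := freeF.
have [p_lin _ p_br] := p_hom.
have [par [e [e_basis e_part eN N0 par_sum]]] :=
  homogeneous_basis idealN.1 complN dimN dimLN.
have [h h_lift] : exists h : 'I_(m + n + k) -> F,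
    forall i, lpart (par i) (h i) /\ p (h i) = e`_i.
  have ex i : exists x, lpart (par i) x /\ p x = e`_i.
    exact: (homogeneous_lift p_hom p_surj (e_part i)).
  exact: (fin_all_exists ex).
pose q : {linear F -> L} :=
  HB.pack p (GRing.isLinear.Build K F L *:%R p p_lin).
pose w := @wedge_br K F _ (m + n) par h.
have span := bracket_spanning char_neq2 p_hom e_basis N0 h_lift.
have RF_ker : lbr_span (p @^-1` [set 0]) [set: F] `<=` q @^-1` [set 0].
  apply: smallest_sub; first exact: (preimage_subspace q (subspace_set0 _)).
  move=> _ [r /= pr0 [y _ <-]].
  by rewrite /= p_br pr0; exact: (linear0 (lbr_flip _)).
have RF_SF : lbr_span (p @^-1` [set 0]) [set: F]
    `<=` lbr_span (p @^-1` [set` N]) [set: F].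
  apply: smallest_sub; first exact: lbr_span_subspace.
  move=> _ [r /= pr0 [y _ <-]]; apply: mem_lbr_span => //=.
  by rewrite pr0 mem0v.
have w_SF ij : lbr_span (p @^-1` [set` N]) [set: F] (w ij).
  apply: mem_lbr_span => //=; rewrite (h_lift _).2 eN //.
  by case/andP: (valP ij).
have [d [dimM d_le d_eq eq_d]] := qdim_ker_of_spanning (lbr_span_subspace _ _)
  (lbr_span_subspace _ _) RF_SF RF_ker w_SF span.
have boundE : bound = #|{: {ij | wedge_pair par (m + n) ij}}|%:R.
  by rewrite card_wedge_pair par_sum wedge_count_rat.
exists d; split=> [//||Lab|].
- by rewrite boundE ler_nat.
- rewrite boundE (d_eq _ _) // => [ij|c cRF].
    by rewrite /= p_br Lab.
  exact: (bracket_independent char_neq2 p_hom e_basis e_part h_lift Lab free_F cRF).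
(* When [d] is the number of pairs, [p] kills the spanning brackets, hence [S, F],
   whose image under [p] is [N, L]. *)
- rewrite boundE => /eqP; rewrite eqr_nat => /eqP /eq_d qw0 z /= zN y.
  have [s sz] := p_surj z; have [f fy] := p_surj y.
  have [c /RF_ker /=] : exists c : {ij | wedge_pair par (m + n) ij} -> K,
      lbr_span (p @^-1` [set 0]) [set: F] (lbr s f - \sum_ij c ij *: w ij).
    by apply: span; apply: mem_lbr_span => //=; rewrite sz.
  rewrite -[p _]/(q _) linearB linear_sum big1 => [|ij _].
    by rewrite subr0 /= p_br sz fy.
  by rewrite linearZ_LR qw0 scaler0.
Qed.
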